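(* Fix $\theta\in\Theta$ and let $p_\theta(x)=\exp(c(x)^\top\theta-\psi(\theta))$ on $\mathbb{R}^d$ and $q_\xi(x)=\exp(\tilde c(x)^\top\xi-\psi(\xi))$, $\xi\in\Xi$, where $c$ and $\tilde c$, the natural statistics of $p_\theta$ and $q_\xi$ respectively, are of class $\mathcal{C}^2$ on $\mathbb{R}^d$, $\psi(\xi)$ is the cumulant-generating function corresponding to $q_\xi$, and $\Xi=\{\xi\in\mathbb{R}^{n_\xi}:\psi(\xi)<\infty\}$. Let $u(x)=\dfrac{p_\theta(x)}{2^d q_\xi(x)}$ and let $\phi_\xi$ be a smooth bijection from $\mathcal{D}=(-1,1)^d$ to $\mathbb{R}^d$ constructed from $q_\xi$. Let $\Xi_0\subseteq\Xi$ be an open convex set. Then $\xi\mapsto E_N[1;\xi]^2$ is convex on $\Xi_0$ if and only if for every $\xi\in\Xi_0$ $$\mathbb{E}_{\theta,N}\left[\frac1u\frac{du}{d\xi};\xi\right]\mathbb{E}_{\theta,N}\left[\frac1u\frac{du}{d\xi};\xi\right]^\top\succeq E_N[1;\xi]\;\mathbb{E}_{\theta,N}\left[\frac1u\frac{d^2u}{d\xi^2};\xi\right].$$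
   Context: For a vector $c:\mathbb{R}^d\to\mathbb{R}^m$ of linearly independent natural statistics, $\psi(\theta)=\log\int_{\mathbb{R}^d}\exp(c(x)^\top\theta)\,dx$ is the cumulant-generating function, and $\Theta=\{\theta\in\mathbb{R}^m:\int_{\mathbb{R}^d}\exp(c(x)^\top\theta)\,dx<\infty\}$ is the natural parameter space. The family $\{p_\theta:\theta\in\Theta\}$, denoted $\mathrm{EM}(c)$, is assumed regular, i.e. $\Theta$ is open. For the family $\mathrm{EM}(\tilde c)$ of $q_\xi$, with $\tilde c:\mathbb{R}^d\to\mathbb{R}^{n_\xi}$, the corresponding function is written $\psi(\xi)=\log\int_{\mathbb{R}^d}\exp(\tilde c(x)^\top\xi)\,dx$ (the same letter $\psi$ is used; the argument tells which family is meant). ''Constructed from $q_\xi$'' means that $\phi_\xi:\mathcal{D}\to\mathbb{R}^d$ is a smooth bijection satisfying $\left|\det\frac{\partial\phi_\xi}{\partial\tilde x}(\tilde x)\right|=\bigl(2^d q_\xi(\phi_\xi(\tilde x))\bigr)^{-1}$ for $\tilde x\in\mathcal{D}$. A $d$-dimensional quadrature rule with positive weight function $\omega$ on $\mathcal{D}$, nodes $\tilde x_1,\dots,\tilde x_N\in\mathcal{D}$ and weights $w_1,\dots,w_N\in\mathbb{R}$ is fixed; it approximates $\int_{\mathcal{D}}g(\tilde x)\omega(\tilde x)\,d\tilde x$ by $Q^{d,\omega}_N g=\sum_{i=1}^N w_i g(\tilde x_i)$. The numerical expectation of $f$ is $$\mathbb{E}_{\theta,N}[f;\xi]=Q^{d,\omega}_N\bigl[f(\phi_\xi)\,u(\phi_\xi)\,\omega^{-1}\bigr]=\sum_{i=1}^N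 w_i\,f(\phi_\xi(\tilde x_i))\,u(\phi_\xi(\tilde x_i))\,\omega(\tilde x_i)^{-1},$$ and the integration error is $E_N[f;\xi]=\mathbb{E}_\theta[f]-\mathbb{E}_{\theta,N}[f;\xi]$, where $\mathbb{E}_\theta$ is the expectation with respect to $p_\theta$; in particular $E_N[1;\xi]=1-\mathbb{E}_{\theta,N}[1;\xi]$. The symbols $\frac{du}{d\xi}$ (a column vector in $\mathbb{R}^{n_\xi}$) and $\frac{d^2u}{d\xi^2}$ (an $n_\xi\times n_\xi$ matrix) are the total first and second derivatives, at fixed $\tilde x$, of $\xi\mapsto u(\phi_\xi(\tilde x))=p_\theta(\phi_\xi(\tilde x))/(2^d q_\xi(\phi_\xi(\tilde x)))$; in $\mathbb{E}_{\theta,N}[\cdot;\xi]$ they are evaluated at each node. These derivatives are understood to exist on $\Xi_0$. For square matrices, $A\succeq B$ means that $A-B$ is positive semidefinite. *)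

(* Defs.v *)
(* Points of R^k are row vectors 'rV[R]_k; gradients are column vectors. *)
From HB Require Import structures.
From mathcomp Require Import all_boot all_order all_algebra.
From mathcomp Require Import all_classical all_reals all_analysis.

Set Implicit Arguments.
Unset Strict Implicit.
Unset Printing Implicit Defensive.

Import Order.TTheory GRing.Theory Num.Theory.
Import numFieldNormedType.Exports.

Local Open Scope classical_set_scope.
Local Open Scope ring_scope.

Definition as_sigma_finite {disp} {T : measurableType disp} {R : realType}
  (mu : {measure set T -> \bar R}) of sigma_finite setT mu :
  set T -> \bar R := mu.

HB.instance Definition _ {disp} {T : measurableType disp} {R : realType}
  (mu : {measure set T -> \bar R}) (muf : sigma_finite setT mu) :=
  Measure.on (as_sigma_finite muf).

HB.instance Definition _ {disp} {T : measurableType disp} {R : realType}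
  (mu : {measure set T -> \bar R}) (muf : sigma_finite setT mu) :=
  @Measure_isSigmaFinite.Build _ _ _ (as_sigma_finite muf) muf.

Section lebesgue_tuple.
Context {R : realType}.
Local Notation RT := (measurableTypeR R).
Local Open Scope ereal_scope.

Definition tcons d (p : RT * d.-tuple RT) : d.+1.-tuple RT :=
  [the d.+1.-tuple RT of p.1 :: p.2].

(* Lebesgue measure on R^d, as a d-fold product.  It lives on tuples because
   the library equips d.-tuple, but not 'rV_d, with the product sigma-algebra. *)
Fixpoint lebesgue_tuple d : set (d.-tuple RT) -> \bar R :=
  match d with
  | 0 => @dirac _ (0.-tuple RT) [tuple] R
  | d'.+1 => pushforward (@lebesgue_measure R \x @lebesgue_tuple d')
               (@tcons d')
  end.

Lemma measurable_tcons d : measurable_fun setT (@tcons d).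
Proof.
exact: (@measurable_cons _ _ _ RT (@fst RT (d.-tuple RT)) d
  (@snd RT (d.-tuple RT)) measurable_fst measurable_snd).
Qed.

Lemma tconsK d (p : RT * d.-tuple RT) :
  (thead (tcons p), [tuple of behead (tcons p)]) = p.
Proof. by case: p => x t; congr pair; apply: val_inj. Qed.

Lemma lebesgue_tuple_sigma_finite_measure d :
  exists m : {sigma_finite_measure set (d.-tuple RT) -> \bar R},
    @lebesgue_tuple d = m.
Proof.
elim: d => [|d [m mE]].
  by exists (@dirac _ (0.-tuple RT) [tuple] R).
pose leb : {sigma_finite_measure set RT -> \bar R} := @lebesgue_measure R.
pose mu := [the {measure set _ -> \bar R} of leb \x m].
have [F FT Foo] : sigma_finite setT mu.
  have /sigma_finiteP[F [TF ndF Foo]] := sigma_finiteT leb.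
  have /sigma_finiteP[G [TG ndG Goo]] := sigma_finiteT m.
  exists (fun n => F n `*` G n).
    rewrite -setXTT TF TG; apply/seteqP; split => [[x y]|[x y] [n _ [? ?]]].
      move=> [/= [n _ Fnx] [k _ Gky]]; exists (maxn n k) => //; split.
      - by move: x Fnx; exact/subsetPset/ndF/leq_maxl.
      - by move: y Gky; exact/subsetPset/ndG/leq_maxr.
    by split; exists n.
  move=> k; have [? ?] := Foo k; have [? ?] := Goo k.
  split; first exact: measurableX.
  by rewrite /= product_measure1E// lte_mul_pinfty// ge0_fin_numE.
have [nu nuE] : exists nu : {measure set (d.+1.-tuple RT) -> \bar R},
    nu = pushforward mu (@tcons d) :> (set _ -> _).
  pose M mf : {measure set _ -> \bar R} :=
    @measure_function_pushforward__canonical__measure_function_Measure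
      _ _ _ _ _ mu (@tcons d) mf.
  by exists (M (@measurable_tcons d)).
have nu_sf : sigma_finite setT nu.
  pose tuncons (t : d.+1.-tuple RT) := (thead t, [tuple of behead t]).
  exists (fun n => tuncons @^-1` F n); first by rewrite -preimage_bigcup -FT.
  move=> n; have [mFn Fnoo] := Foo n; split.
    rewrite -[X in measurable X]setTI.
    apply: (@measurable_fun_pair _ _ _ _ _ _ (@thead d RT)
      (fun t : d.+1.-tuple RT => [tuple of behead t])) => //.
    - exact: measurable_tnth.
    - exact: measurable_behead.
  rewrite nuE /pushforward.
  suff -> : @tcons d @^-1` (tuncons @^-1` F n) = F n by [].
  by apply/seteqP; split => p /=; rewrite /tuncons tconsK.
exists (as_sigma_finite nu_sf).
by rewrite /= mE -nuE.
Qed.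

Let lebesgue_tuple0 d : @lebesgue_tuple d set0 = 0.
Proof. by have [m ->] := lebesgue_tuple_sigma_finite_measure d. Qed.

Let lebesgue_tuple_ge0 d A : 0 <= @lebesgue_tuple d A.
Proof. by have [m ->] := lebesgue_tuple_sigma_finite_measure d. Qed.

Let lebesgue_tuple_sigma_additive d : semi_sigma_additive (@lebesgue_tuple d).
Proof.
have [m ->] := lebesgue_tuple_sigma_finite_measure d.
exact: measure_semi_sigma_additive.
Qed.

HB.instance Definition _ d := isMeasure.Build _ _ _ (@lebesgue_tuple d)
  (@lebesgue_tuple0 d) (@lebesgue_tuple_ge0 d)
  (@lebesgue_tuple_sigma_additive d).

Let lebesgue_tuple_sigma_finite d : sigma_finite setT (@lebesgue_tuple d).
Proof.
have [m ->] := lebesgue_tuple_sigma_finite_measure d; exact: sigma_finiteT.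
Qed.

HB.instance Definition _ d := @Measure_isSigmaFinite.Build _ _ _
  (@lebesgue_tuple d) (@lebesgue_tuple_sigma_finite d).

Definition row_of_tuple d (t : d.-tuple RT) : 'rV[R]_d := \row_i tnth t i.

Definition integral_rV d (f : 'rV[R]_d -> \bar R) : \bar R :=
  \int[@lebesgue_tuple d]_t f (row_of_tuple t).

End lebesgue_tuple.

Section calculus.
Context {R : realType}.

Definition partial m n1 n2 (i : 'I_m) (f : 'rV[R]_m -> 'M[R]_(n1, n2)) :
    'rV[R]_m -> 'M[R]_(n1, n2) :=
  'D_(delta_mx 0 i) f.

(* Meant for open D, where it is the usual C^k. *)
Fixpoint is_Ck (k : nat) m n (D : set 'rV[R]_m) (f : 'rV[R]_m -> 'rV[R]_n) :
    Prop :=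
  match k with
  | 0 => forall x, D x -> {for x, continuous f}
  | k'.+1 => (forall x, D x -> differentiable f x) /\
             (forall i, is_Ck k' D (partial i f))
  end.

Definition gradient n (F : 'rV[R]_n -> R^o) (xi : 'rV[R]_n) : 'cV[R]_n :=
  \col_i 'D_(delta_mx 0 i) F xi.

Definition hessian n (F : 'rV[R]_n -> R^o) (xi : 'rV[R]_n) : 'M[R]_n :=
  \matrix_(i, j) partial j (gradient F) xi i 0.

Definition twice_differentiable n (F : 'rV[R]_n -> R^o) (xi : 'rV[R]_n) :=
  (\forall z \near xi, differentiable F z) /\ differentiable (gradient F) xi.

Definition psdmx n (A : 'M[R]_n) : Prop :=
  A^T = A /\ forall v : 'cV[R]_n, 0 <= (v^T *m A *m v) 0 0.

Definition loewner_ge n (A B : 'M[R]_n) : Prop := psdmx (A - B).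

End calculus.

Section exponential_family.
Context {R : realType} {d m : nat}.
Variable c : 'rV[R]_d -> 'rV[R]_m.

Definition dotr k (v w : 'rV[R]_k) : R := \sum_(i < k) v 0 i * w 0 i.

Definition partition_function (theta : 'rV[R]_m) : \bar R :=
  integral_rV (fun x => (expR (dotr (c x) theta))%:E).

(* psi, with value +oo where the integral diverges *)
Definition cumulant (theta : 'rV[R]_m) : \bar R :=
  lne (partition_function theta).

Definition natural_parameter_space : set 'rV[R]_m :=
  [set theta | (partition_function theta < +oo)%E].

Definition density (theta : 'rV[R]_m) (x : 'rV[R]_d) : R :=
  expR (dotr (c x) theta - fine (cumulant theta)).

Definition expectation_EM (theta : 'rV[R]_m) (f : 'rV[R]_d -> R) : R :=
  fine (integral_rV (fun x => (f x * density theta x)%:E)).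

Definition linearly_independent_statistics : Prop :=
  forall a : 'rV[R]_m, (forall x, dotr (c x) a = 0) -> a = 0.

Definition regular_EM : Prop :=
  linearly_independent_statistics /\ open natural_parameter_space.

End exponential_family.

Section quadrature.
Context {R : realType} {d m n N : nat}.

Definition cube : set 'rV[R]_d := [set x | forall i, -1 < x 0 i < 1].

(* phi is a C^1 bijection from the cube onto R^d that pulls q_xi back to the
   uniform density 2^-d.  C^1 is what the Jacobian condition requires;
   that condition precludes C^oo unless q_xi is itself C^oo.  'J is the
   transpose of the usual Jacobian matrix, with the same determinant. *)
Definition constructed_from (ct : 'rV[R]_d -> 'rV[R]_n) (xi : 'rV[R]_n)
    (phi : 'rV[R]_d -> 'rV[R]_d) : Prop :=
  [/\ set_bij cube setT phi,
      is_Ck 1 cube phi &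
      forall xt, cube xt ->
        `|\det ('J phi xt)| = (2 ^+ d * density ct xi (phi xt))^-1].

Variables (c : 'rV[R]_d -> 'rV[R]_m) (theta : 'rV[R]_m).
Variable ct : 'rV[R]_d -> 'rV[R]_n.
Variable phi : 'rV[R]_n -> 'rV[R]_d -> 'rV[R]_d.

Definition ratio (xi : 'rV[R]_n) (x : 'rV[R]_d) : R :=
  density c theta x / (2 ^+ d * density ct xi x).

(* xi |-> u(phi_xi(xt)), where u itself depends on xi through q_xi *)
Definition pulled_ratio (xt : 'rV[R]_d) (xi : 'rV[R]_n) : R^o :=
  ratio xi (phi xi xt).

Variables (omega : 'rV[R]_d -> R) (node : 'I_N -> 'rV[R]_d) (w : 'I_N -> R).

Definition quadrature (V : lmodType R) (g : 'rV[R]_d -> V) : V :=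
  \sum_(i < N) w i *: g (node i).

(* The integrand is given on the cube: the numerical expectation of f is
   numerical_expectation (f \o phi xi) xi.  This accommodates integrands such
   as u^-1 du/dxi, which are functions of the node xt rather than of
   phi_xi(xt). *)
Definition numerical_expectation (V : lmodType R) (F : 'rV[R]_d -> V)
    (xi : 'rV[R]_n) : V :=
  quadrature (fun xt => (pulled_ratio xt xi * (omega xt)^-1) *: F xt).

Definition integration_error (f : 'rV[R]_d -> R^o) (xi : 'rV[R]_n) : R :=
  expectation_EM c theta f - numerical_expectation (f \o phi xi) xi.

Definition log_gradient (xi : 'rV[R]_n) (xt : 'rV[R]_d) : 'cV[R]_n :=
  (pulled_ratio xt xi)^-1 *: gradient (pulled_ratio xt) xi.

Definition scaled_hessian (xi : 'rV[R]_n) (xt : 'rV[R]_d) : 'M[R]_n :=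
  (pulled_ratio xt xi)^-1 *: hessian (pulled_ratio xt) xi.

End quadrature.

(* Main.v *)
Require Import Defs.
From HB Require Import structures.
From mathcomp Require Import all_boot all_order all_algebra.
From mathcomp Require Import all_classical all_reals all_analysis.
From mathcomp Require Import ring lra.

Set Implicit Arguments.
Unset Strict Implicit.
Unset Printing Implicit Defensive.

Import Order.TTheory GRing.Theory Num.Theory.
Import numFieldNormedType.Exports.

Local Open Scope classical_set_scope.
Local Open Scope ring_scope.

(** For fixed nodes, the quadrature of the constant 1 is a linear combination
    of the functions [u_i : xi |-> u (phi_xi (xt_i))] with constant
    coefficients [a_i = w_i / omega (xt_i)], so the integration error is
    [E = K - \sum_i a_i u_i] with [K] independent of [xi].  The factor [1 / u]
    in the two matrix expectations cancels the [u] carried by the quadrature,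
    whence they are [g = \sum_i a_i grad u_i = - grad E] and
    [H = \sum_i a_i hess u_i = - hess E].  The product rule then gives
      [hess (E ^ 2) = 2 (grad E (grad E)^T + E hess E) = 2 (g g^T - E H)],
    and the theorem is the second order characterisation of convexity applied
    to [E ^ 2].

    That characterisation has to be proved for functions which are only twice
    differentiable at each point, without continuity of the second
    derivatives.  The tool is the second difference
      [F (x + t a + t b) - F (x + t a) - F (x + t b) + F x],
    which is [t ^ 2 (a hess F b^T) + o (t ^ 2)] (second_difference_estimate):
    the mean value theorem turns it into an increment of the derivative along
    [a], and the differentiability of the gradient at [x] estimates the latter.
    Two consequences follow.
    - The second difference is symmetric in [a] and [b], so the Hessian is
      symmetric (hessian_tr).  Positive semidefiniteness includes symmetry, so
      this is a genuine part of the claim.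
    - For [a = b] convexity makes it nonnegative, so the Hessian of a convex
      function is positive semidefinite (convex_function_psd_hessian).
    Conversely, a positive semidefinite Hessian makes the second derivative
    along every segment nonnegative, and the one-variable criterion concludes
    (psd_hessian_convex_function). *)

(** * Gradients, Hessians and restrictions to lines *)

Lemma near_eq_differentiable (R : numFieldType) (V W : normedModType R)
    (f g : V -> W) (x : V) :
  (\forall z \near x, f z = g z) -> differentiable f x -> differentiable g x.
Proof.
move=> fg df.
have gE : g \o shift x = cst (g x) + 'd f x +o_ 0 id.
  apply/eqaddoP => e e0.
  have /eqaddoP/(_ e e0) := diff_locally df.
  rewrite -(nbhs_singleton fg).
  have fg0 : \forall y \near 0, f (y + x) = g (y + x).
    move: fg; rewrite (near_shift 0); apply: filterS => y /=.
    by rewrite subr0.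
  by apply: filterS2 fg0 => y /= fgy; rewrite !fctE /= fgy.
have dgE := diff_unique (diff_continuous df) gE.
by apply/diff_locallyP; rewrite dgE; split => //; exact: diff_continuous.
Qed.

Section gradient_hessian.
Context {R : realType} {n : nat}.
Implicit Types (F : 'rV[R]_n -> R^o) (x v : 'rV[R]_n).

Lemma derive_gradient F x v :
  differentiable F x -> 'D_v F x = (v *m gradient F x) 0 0.
Proof.
move=> dF; rewrite deriveE// [in LHS](row_sum_delta v) linear_sum mxE.
by apply: eq_bigr => i _; rewrite linearZ mxE deriveE.
Qed.

Lemma hessianE F x i j : differentiable (gradient F) x ->
  hessian F x i j = 'D_(delta_mx 0 j) (fun z => gradient F z i 0) x.
Proof.
by move=> dg; rewrite mxE /partial derive_mx ?mxE//; exact: diff_derivable.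
Qed.

Lemma differentiable_mx_coord (g : 'rV[R]_n -> 'cV[R]_n) x i :
  differentiable g x -> differentiable (fun z => g z i 0 : R) x.
Proof.
move=> dg.
apply: (@differentiable_comp _ _ _ _ g (fun N : 'cV[R]_n => N i 0 : R)) => //.
exact: differentiable_coord.
Qed.

(** Lets the gradients computed below be differentiated entry by entry. *)
Lemma differentiable_cV (g : 'rV[R]_n -> 'cV[R]_n) x :
  (forall i, differentiable (fun z => g z i 0 : R) x) -> differentiable g x.
Proof.
move=> dg.
have -> : g = \sum_(i < n) (fun z => g z i 0 *: delta_mx i 0).
  apply/funext => z; rewrite fct_sumE; apply/matrixP => i j.
  rewrite summxE ord1 (bigD1 i)//= big1 ?addr0; last first.
    by move=> k ki; rewrite !mxE eq_sym (negbTE ki) mulr0.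
  by rewrite !mxE !eqxx mulr1.
by apply: differentiable_sum => i; exact: differentiableZl.
Qed.

(** Where [F] is differentiable this pairing is the derivative of [F] along
    [v]; it is linear in the gradient, so it inherits its differentiability. *)
Lemma differentiable_gradient_form F x v : differentiable (gradient F) x ->
  differentiable (fun z => (v *m gradient F z) 0 0 : R) x.
Proof.
move=> dg.
have -> : (fun z => (v *m gradient F z) 0 0 : R) =
    \sum_(i < n) (v 0 i *: (fun z => gradient F z i 0 : R)).
  by apply/funext => z; rewrite fct_sumE mxE.
by apply: differentiable_sum => i; apply: differentiableZ;
  exact: differentiable_mx_coord.
Qed.

Lemma derive_gradient_form F x v w : differentiable (gradient F) x ->
  'D_w (fun z => (v *m gradient F z) 0 0 : R) x =
  (v *m hessian F x *m w^T) 0 0.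
Proof.
move=> dg.
have -> : (fun z => (v *m gradient F z) 0 0 : R) =
    \sum_(i < n) (v 0 i *: (fun z => gradient F z i 0 : R)).
  by apply/funext => z; rewrite fct_sumE mxE.
have dgi i : differentiable (fun z => gradient F z i 0 : R) x.
  exact: differentiable_mx_coord.
rewrite derive_sum; last first.
  by move=> i; apply/diff_derivable/differentiableZ.
rewrite -mulmxA mxE; apply: eq_bigr => i _.
rewrite deriveZ; last exact: diff_derivable.
congr (_ * _); rewrite mxE deriveE// [in LHS](row_sum_delta w) linear_sum.
by apply: eq_bigr => j _; rewrite linearZ/= hessianE// deriveE// mxE mulrC.
Qed.

(** The two difference quotients are the same function of the increment. *)
Lemma is_derive_line F x v t df : is_derive (x + t *: v) v F df ->
  is_derive t 1 (fun s : R => F (x + s *: v)) df.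
Proof.
have qE : (fun h : R => h^-1 *: ((F \o shift (x + t *: v)) (h *: v)
      - F (x + t *: v))) =
    (fun h : R => h^-1 *: (((fun s : R => F (x + s *: v)) \o shift t) (h *: 1)
      - F (x + t *: v))).
  apply/funext => h /=; congr (_ *: (F _ - _)).
  by rewrite scalerDl [h *: 1]mulr1 addrCA.
by move=> [dF vF]; split; [rewrite /derivable -qE|rewrite /derive -qE].
Qed.

End gradient_hessian.

(** * The second difference and the symmetry of the Hessian *)

Section second_difference.
Context {R : realType} {n : nat}.
Implicit Types (F : 'rV[R]_n -> R^o) (x a b : 'rV[R]_n).

(** With [f s] the increment of [F] from [x + s a] to [x + t b + s a], the
    second difference is [f t - f 0 = t * f' s] for some [s] between 0 and [t].
    Here [f' s] is the increment of the derivative [p] of [F] along [a].  Its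
    first order expansion at [x] gives [t * 'd p x b], with an error bounded by
    a small multiple of the norms of [s a] and [t b + s a], hence of [t]. *)
Lemma second_difference_estimate F x a b e :
  twice_differentiable F x -> 0 < e ->
  \forall t \near (0 : R)^'+,
    `|F (x + t *: b + t *: a) - F (x + t *: a) - (F (x + t *: b) - F x)
      - t ^+ 2 * (a *m hessian F x *m b^T) 0 0| <= e * t ^+ 2.
Proof.
move=> [nF dg] e0.
pose p z : R := (a *m gradient F z) 0 0.
have dp : differentiable p x by exact: differentiable_gradient_form.
(* [t * C] bounds the norms of both [s a] and [t b + s a] for [0 <= s <= t],
   and the two remainders contribute [e / (2 * C) * (t * C)] each. *)
pose C := `|a| + `|b| + 1.
have C0 : 0 < C by rewrite ltr_wpDl// addr_ge0.
have e'0 : 0 < e / (2 * C) by rewrite divr_gt0// mulr_gt0.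
have /eqaddoP/(_ _ e'0) pE := diff_locally dp.
have nF0 : \forall y \near (0 : 'rV[R]_n), differentiable F (y + x).
  by move: nF; rewrite (near_shift 0); apply: filterS => y /=; rewrite subr0.
have : nbhs (0 : 'rV[R]_n) (fun y => `|(p \o shift x - (cst (p x) + 'd p x)) y|
    <= e / (2 * C) * `|y| /\ differentiable F (y + x)) by exact: filterI.
move=> /nbhs_ballP[r /= r0 near_x].
have {}near_x y : `|y| < r ->
    `|p (x + y) - p x - 'd p x y| <= e / (2 * C) * `|y| /\
    differentiable F (x + y).
  move=> yr; have /near_x[] : ball (0 : 'rV[R]_n) r y.
    by rewrite -ball_normE /= sub0r normrN.
  rewrite !fctE /= -(addrC x) opprD addrA => ? ?; split => //.
near=> t.
have t0 : 0 < t by near: t; exact: nbhs_right_gt.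
have tC : t * C < r.
  rewrite -ltr_pdivlMr//; near: t; apply: nbhs_right_lt.
  by rewrite divr_gt0.
have ta s : 0 <= s <= t -> `|s *: a| <= t * `|a|.
  by move=> /andP[s0 st]; rewrite normrZ ger0_norm// ler_wpM2r.
have tb : `|t *: b| = t * `|b| by rewrite normrZ gtr0_norm.
have tab s : 0 <= s <= t -> `|t *: b + s *: a| <= t * (`|a| + `|b|).
  by move=> /ta sa; rewrite (le_trans (ler_normD _ _))// tb mulrDr addrC lerD.
have taC : t * `|a| <= t * (`|a| + `|b|) by rewrite ler_pM2l// lerDl.
have tabC : t * (`|a| + `|b|) < r.
  by rewrite (le_lt_trans _ tC)// ler_pM2l// lerDl.
pose f s : R := F (x + t *: b + s *: a) - F (x + s *: a).
pose df s : R := p (x + t *: b + s *: a) - p (x + s *: a).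
have fE s : 0 <= s <= t -> is_derive s 1 f (df s).
  move=> st; apply: is_deriveB; apply: is_derive_line; apply: DeriveDef.
  - by apply: diff_derivable; rewrite -addrA;
      apply: (near_x _ _).2; exact: le_lt_trans (tab _ st) tabC.
  - by rewrite derive_gradient//; rewrite -addrA;
      apply: (near_x _ _).2; exact: le_lt_trans (tab _ st) tabC.
  - by apply: diff_derivable;
      apply: (near_x _ _).2; exact: le_lt_trans (le_trans (ta _ st) taC) tabC.
  - by rewrite derive_gradient//;
      apply: (near_x _ _).2; exact: le_lt_trans (le_trans (ta _ st) taC) tabC.
have [s sI fs] : exists2 s, s \in `]0, t[%R & f t - f 0 = df s * (t - 0).
  apply: MVT => //.
    by move=> s /[!in_itv]/= /andP[/ltW s0 /ltW st]; apply: fE; rewrite s0.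
  apply: derivable_within_continuous => s /[!in_itv]/= st.
  by apply: ex_derive; exact: fE.
have {}sI : 0 <= s <= t by move: sI => /[!in_itv]/= /andP[/ltW-> /ltW->].
have -> : F (x + t *: b + t *: a) - F (x + t *: a) - (F (x + t *: b) - F x) =
    t * df s.
  by move: fs; rewrite subr0 mulrC => <-; rewrite /f !scale0r !addr0.
have HE : (a *m hessian F x *m b^T) 0 0 = 'd p x b.
  by rewrite -deriveE// derive_gradient_form.
have dE : 'd p x (t *: b + s *: a) - 'd p x (s *: a) = t * 'd p x b.
  by rewrite linearD linearZ/= addrK.
rewrite HE expr2 -mulrA -mulrBr -dE normrM gtr0_norm// mulrCA ler_pM2l//.
have [h1 _] := near_x _ (le_lt_trans (tab _ sI) tabC).
have [h2 _] := near_x _ (le_lt_trans (le_trans (ta _ sI) taC) tabC).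
rewrite /df -[x + _ + _]addrA.
have -> : p (x + (t *: b + s *: a)) - p (x + s *: a) -
    ('d p x (t *: b + s *: a) - 'd p x (s *: a)) =
    (p (x + (t *: b + s *: a)) - p x - 'd p x (t *: b + s *: a)) -
    (p (x + s *: a) - p x - 'd p x (s *: a)) by ring.
rewrite (le_trans (ler_normB _ _))// (le_trans (lerD h1 h2))// -mulrDr.
have -> : e * t = e / (2 * C) * (t * C + t * C).
  by field; rewrite gt_eqF.
rewrite ler_pM2l//; apply: lerD.
  by rewrite (le_trans (tab _ sI))// ler_pM2l// lerDl.
by rewrite (le_trans (ta _ sI))// (le_trans taC)// ler_pM2l// lerDl.
Unshelve. all: by end_near. Qed.

(** Exchanging the two directions leaves the second difference unchanged, so
    both mixed entries are limits of the same quotient. *)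
Lemma hessian_tr F x :
  twice_differentiable F x -> (hessian F x)^T = hessian F x.
Proof.
move=> tF; apply/matrixP => i j; rewrite mxE.
have entry (A : 'M[R]_n) k l : A k l =
    ((delta_mx 0 k : 'rV_n) *m A *m (delta_mx 0 l : 'rV_n)^T) 0 0.
  by rewrite trmx_delta -colE mxE -rowE mxE.
apply/eqP; rewrite -subr_eq0 -normr_le0; apply/ler_addgt0Pl => e e0.
rewrite addr0.
near (0 : R)^'+ => t.
have t0 : 0 < t by near: t; exact: nbhs_right_gt.
pose ei : 'rV[R]_n := delta_mx 0 i; pose ej : 'rV[R]_n := delta_mx 0 j.
have : `|F (x + t *: ej + t *: ei) - F (x + t *: ei) - (F (x + t *: ej) - F x)
      - t ^+ 2 * (ei *m hessian F x *m ej^T) 0 0| <= e / 2 * t ^+ 2.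
  by near: t; apply: second_difference_estimate => //; rewrite divr_gt0.
have : `|F (x + t *: ei + t *: ej) - F (x + t *: ej) - (F (x + t *: ei) - F x)
      - t ^+ 2 * (ej *m hessian F x *m ei^T) 0 0| <= e / 2 * t ^+ 2.
  by near: t; apply: second_difference_estimate => //; rewrite divr_gt0.
rewrite -!entry -[x + t *: ei + t *: ej]addrAC => h1 h2.
rewrite -(ler_pM2r (exprn_gt0 2 t0)) -{1}[t ^+ 2]gtr0_norm ?exprn_gt0//.
rewrite -normrM.
move: h1 h2; rewrite !ler_norml => /andP[? ?] /andP[? ?].
by apply/andP; split; lra.
Unshelve. all: by end_near. Qed.

End second_difference.

(** * Convexity and the Hessian *)

Lemma conv_lmodE (R : numDomainType) (M : lmodType R) (t : {i01 R})
    (x y : convex_lmodType M) :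
  conv t x y = (y : M) + t%:num *: ((x : M) - (y : M)) :> M.
Proof. by rewrite /conv/= scalerBl scale1r scalerBr addrCA. Qed.

Section convexity.
Context {R : realType} {n : nat}.
Implicit Types (F : 'rV[R]_n -> R^o) (x v : 'rV[R]_n) (D : set 'rV[R]_n).

(** The second difference with both directions equal to [v^T] compares [F] at
    [x + t v^T] with the mean of its values at [x] and [x + 2 t v^T], so it is
    nonnegative; dividing by [t ^ 2] leaves the quadratic form up to [e]. *)
Lemma convex_function_psd_hessian F D x : open D ->
  @convex_function R 'rV[R]_n D F -> D x -> twice_differentiable F x ->
  psdmx (hessian F x).
Proof.
move=> oD cF Dx tF; split; first exact: hessian_tr.
move=> v; apply/ler_addgt0Pl => e e0.
pose a := v^T.
pose g (t : R) : 'rV[R]_n := x + t *: a + t *: a.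
have cg : g t @[t --> (0 : R)] --> x.
  have -> : nbhs x = nbhs (x + (0 : R) *: a + (0 : R) *: a).
    by rewrite scale0r !addr0.
  apply: cvgD; [apply: cvgD|]; first exact: cvg_cst.
  - by apply: cvgZr_tmp; exact: cvg_id.
  - by apply: cvgZr_tmp; exact: cvg_id.
have Dg : \forall t \near (0 : R)^'+, D (g t).
  by apply: cvg_within; apply: cg; exact: open_nbhs_nbhs.
near (0 : R)^'+ => t.
have t0 : 0 < t by near: t; exact: nbhs_right_gt.
have : `|F (x + t *: a + t *: a) - F (x + t *: a) - (F (x + t *: a) - F x)
      - t ^+ 2 * (a *m hessian F x *m a^T) 0 0| <= e * t ^+ 2.
  by near: t; exact: second_difference_estimate.
have Dxt : D (x + t *: a + t *: a) by near: t.
have mid : F (x + t *: a) <= 2^-1 * F (x + t *: a + t *: a) + 2^-1 * F x.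
  have h0 : 0 <= 2^-1 :> R by rewrite invr_ge0.
  have h1 : 2^-1 <= 1 :> R by rewrite invf_le1// ler1n.
  have := cF (Itv01 h0 h1) (x + t *: a + t *: a) x (mem_set Dxt) (mem_set Dx).
  rewrite (conv_lmodE (M := 'rV[R]_n)) convRE/=.
  have -> : x + 2^-1 *: (x + t *: a + t *: a - x) = x + t *: a.
    congr (_ + _); rewrite -[x + _ + _]addrA addrAC subrr add0r -mulr2n.
    by rewrite -[t *: a *+ 2]scaler_nat scalerK ?pnatr_eq0.
  by rewrite /unstable.onem; lra.
rewrite ler_norml => /andP[_] est.
have t20 : 0 < t ^+ 2 by rewrite exprn_gt0.
rewrite -(ler_pM2l t20) mulr0 mulrDr.
rewrite trmxK in est.
lra.
Unshelve. all: by end_near. Qed.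

(** Along a segment with direction [v] the second derivative of [F] is the
    Hessian form at [v], so the one-variable criterion applies. *)
Lemma psd_hessian_convex_function F D :
  @convex_set R 'rV[R]_n D ->
  (forall x, D x -> twice_differentiable F x) ->
  (forall x, D x -> psdmx (hessian F x)) ->
  @convex_function R 'rV[R]_n D F.
Proof.
move=> cD tF pF t x0 y0; rewrite !inE.
pose x : 'rV[R]_n := x0; pose y : 'rV[R]_n := y0.
move=> Dx Dy.
pose v : 'rV[R]_n := y - x.
pose h (s : R) : R^o := F (x + s *: v).
have Dl (s : R) : 0 <= s <= 1 -> D (x + s *: v).
  move=> /andP[s0 s1].
  have := cD y x (Itv01 s0 s1) (mem_set Dy) (mem_set Dx).
  by rewrite inE (conv_lmodE (M := 'rV[R]_n)).
have dh (s : R) : 0 <= s <= 1 -> \forall r \near s,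
    is_derive (r : R) (1 : R) h ((v *m gradient F (x + r *: v)) 0 0).
  move=> /Dl/tF[+ _].
  have cl : x + r *: v @[r --> s] --> x + s *: v.
    by apply: cvgD; [exact: cvg_cst|apply: cvgZr_tmp; exact: cvg_id].
  move=> nF; have {}nF : \forall r \near s, differentiable F (x + r *: v).
    exact: cl nF.
  apply: filterS nF => r dF.
  apply: is_derive_line; apply: DeriveDef; first exact: diff_derivable.
  exact: derive_gradient.
have ddh (s : R) : 0 <= s <= 1 -> is_derive (s : R) (1 : R) ('D_1 h)
    ((v *m hessian F (x + s *: v) *m v^T) 0 0).
  move=> s01; apply: (@near_eq_is_derive _ _ _
    (fun r : R => (v *m gradient F (x + r *: v)) 0 0 : R)).
    by move: (dh s s01); apply: filterS => r dhr; rewrite derive_val.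
  have [_ dg] := tF _ (Dl s s01).
  apply: (is_derive_line (F := fun z => (v *m gradient F z) 0 0)).
  apply: DeriveDef; first exact/diff_derivable/differentiable_gradient_form.
  exact: derive_gradient_form.
have ch (s : R) : 0 <= s <= 1 -> h @ s --> h s.
  move=> /dh/nbhs_singleton [dhs _].
  by apply: differentiable_continuous; apply/derivable1_diffP.
have hE : h (conv t (0 : R^o) 1) <= conv t (h 0) (h 1).
  apply: second_derivative_convex => //.
  - move=> s /andP[/ltW s0 /ltW s1]; have s01 : 0 <= s <= 1 by rewrite s0.
    have [_ ->] := ddh s s01; have [_ /(_ v^T)] := pF _ (Dl s s01).
    by rewrite trmxK.
  - by apply: cvg_at_left_filter; apply: ch; rewrite ler01 lexx.
  - by apply: cvg_at_right_filter; apply: ch; rewrite ler01 lexx.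
  - move=> s /[!in_itv]/= /andP[/ltW s0 /ltW s1].
    have /dh/nbhs_singleton[//] : 0 <= s <= 1 by rewrite s0.
  - move=> s /[!in_itv]/= /andP[/ltW s0 /ltW s1].
    have /ddh[//] : 0 <= s <= 1 by rewrite s0.
(* [conv t] puts the weight [t] on its first argument, so the point sits at
   parameter [1 - t = conv t 0 1] on the line from [x] to [y]. *)
have -> : conv t x0 y0 = x + conv t (0 : R^o) 1 *: v :> 'rV[R]_n.
  rewrite convC (conv_lmodE (M := 'rV[R]_n))/= -/x -/y -/v.
  by rewrite convRE mulr0 add0r mulr1.
have -> : F x0 = h 0 by rewrite /h scale0r addr0.
have -> : F y0 = h 1 by rewrite /h scale1r /v addrC subrK.
exact: hE.
Qed.

End convexity.

(** * Second order calculus of affine combinations and squares *)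

Section calculus_rules.
Context {R : realType} {n : nat}.
Implicit Types (F : 'rV[R]_n -> R^o) (x : 'rV[R]_n).

(** The Hessian depends only on the gradient near the point, so it can be
    computed from any formula [g] for the gradient that holds nearby. *)
Lemma twice_differentiable_gradientE F (g : 'rV[R]_n -> 'cV[R]_n) x :
  (\forall z \near x, differentiable F z /\ gradient F z = g z) ->
  differentiable g x ->
  twice_differentiable F x /\
  forall i j, hessian F x i j = 'D_(delta_mx 0 j) (fun z => g z i 0 : R) x.
Proof.
move=> nF dg.
have dF : differentiable (gradient F) x.
  by apply: near_eq_differentiable dg; apply: filterS nF => z [_ ->].
split; first by split => //; apply: filterS nF => z [].
move=> i j; rewrite hessianE//; apply: near_eq_derive.
by apply: filterS nF => z [_ ->].
Qed.

Lemma twice_differentiable_affine (N : nat) (K : R) (a : 'I_N -> R)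
    (u : 'I_N -> 'rV[R]_n -> R^o) x :
  (forall k, twice_differentiable (u k) x) ->
  let F : 'rV[R]_n -> R^o := fun z => K - \sum_(k < N) a k * u k z in
  [/\ twice_differentiable F x,
      gradient F x = - \sum_(k < N) a k *: gradient (u k) x &
      hessian F x = - \sum_(k < N) a k *: hessian (u k) x].
Proof.
move=> tu F.
have FE : F = cst K - \sum_(k < N) (a k *: u k).
  by apply/funext => z; rewrite !fctE /= fct_sumE.
pose g z := - \sum_(k < N) a k *: gradient (u k) z.
have gE z i : g z i 0 = - \sum_(k < N) a k * gradient (u k) z i 0.
  by rewrite mxE summxE; congr (- _); apply: eq_bigr => k _; rewrite mxE.
have nF : \forall z \near x, differentiable F z /\ gradient F z = g z.
  have ndu : nbhs x [set z | forall k, differentiable (u k) z].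
    exact: (@filter_forall _ _ (fun k => [set z | differentiable (u k) z])
      (nbhs x) _ (fun k => (tu k).1)).
  apply: filterS ndu => z /= du.
  have dku k : differentiable (a k *: u k) z by exact: differentiableZ.
  split.
    rewrite FE; apply: differentiableB; first exact: differentiable_cst.
    exact: differentiable_sum.
  apply/matrixP => i j; rewrite ord1 gE mxE FE deriveB; last 2 first.
    - exact: derivable_cst.
    - exact/diff_derivable/differentiable_sum.
  rewrite derive_cst sub0r derive_sum; last by move=> k; exact: diff_derivable.
  congr (- _); apply: eq_bigr => k _.
  by rewrite deriveZ ?mxE//; exact: diff_derivable.
have dgi k i : differentiable (fun z => gradient (u k) z i 0 : R) x.
  by apply: differentiable_mx_coord; have [] := tu k.
have giE i : (fun z => g z i 0 : R) =
    - \sum_(k < N) (a k *: (fun z => gradient (u k) z i 0 : R)).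
  by apply/funext => z; rewrite gE !fctE /= fct_sumE.
have dg : differentiable g x.
  apply: differentiable_cV => i; rewrite giE; apply: differentiableN.
  by apply: differentiable_sum => k; exact: differentiableZ.
have [tF HE] := twice_differentiable_gradientE nF dg.
split => //; first by have [_ ->] := nbhs_singleton nF.
apply/matrixP => i j; rewrite HE giE deriveN; last first.
  by apply/diff_derivable/differentiable_sum => k; exact: differentiableZ.
rewrite derive_sum; last by move=> k; apply/diff_derivable/differentiableZ.
rewrite mxE summxE; congr (- _); apply: eq_bigr => k _.
rewrite deriveZ; last exact: diff_derivable.
by rewrite mxE hessianE//; have [] := tu k.
Qed.

(** The formula [grad (F ^ 2) = 2 F grad F] holds near [x]; differentiating it
    once more produces the outer product and the Hessian term. *)
Lemma twice_differentiable_sqr F x : twice_differentiable F x ->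
  let G : 'rV[R]_n -> R^o := fun z => F z ^+ 2 in
  twice_differentiable G x /\
  hessian G x =
    2 *: (gradient F x *m (gradient F x)^T + F x *: hessian F x).
Proof.
move=> tF G; have [nF dgF] := tF.
have GE : G = (F : _ -> R) * F by apply/funext => z; rewrite /G expr2.
pose g z : 'cV[R]_n := (2 * F z) *: gradient F z.
have nG : \forall z \near x, differentiable G z /\ gradient G z = g z.
  apply: filterS nF => z dF; split; first by rewrite GE; exact: differentiableM.
  apply/matrixP => i j; rewrite ord1 !mxE GE.
  rewrite deriveM; try exact: diff_derivable.
  by rewrite /GRing.scale/=; ring.
have dF : differentiable F x := nbhs_singleton nF.
have giE i : (fun z => g z i 0 : R) =
    2 *: ((F : _ -> R) * (fun z => gradient F z i 0 : R)).
  by apply/funext => z; rewrite [LHS]mxE !fctE -mulrA.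
have dgi i : differentiable (fun z => gradient F z i 0 : R) x.
  exact: differentiable_mx_coord.
have dg : differentiable g x.
  apply: differentiable_cV => i; rewrite giE.
  by apply: differentiableZ; exact: differentiableM.
have [tG HE] := twice_differentiable_gradientE nG dg.
split => //; apply/matrixP => i j; rewrite HE giE.
rewrite deriveZ; last by apply/diff_derivable/differentiableM.
rewrite deriveM; try exact: diff_derivable.
rewrite -hessianE// [in RHS]mxE [in RHS]mxE [X in _ = _ * (_ + X)]mxE.
congr (_ * _).
rewrite [X in _ = X + _]mxE big_ord1 [_^T _ _]mxE [X in _ = _ * X + _]mxE.
by rewrite /GRing.scale/=; ring.
Qed.

Lemma psdmxZ (c : R) (A : 'M[R]_n) : 0 < c -> psdmx (c *: A) <-> psdmx A.
Proof.
move=> c0.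
have scal (b : R) (B : 'M[R]_n) : 0 <= b -> psdmx B -> psdmx (b *: B).
  move=> b0 [Bt B0]; split; first by rewrite linearZ/= Bt.
  by move=> v; rewrite -scalemxAr -scalemxAl mxE mulr_ge0.
split; last exact/scal/ltW.
rewrite -[A in X in _ -> X](scalerK (lt0r_neq0 c0)).
by apply: scal; rewrite invr_ge0 ltW.
Qed.

End calculus_rules.

(** * The quadrature error *)

Section quadrature.
Context {R : realType} {d m n N : nat}.
Context (c : 'rV[R]_d -> 'rV[R]_m) (theta : 'rV[R]_m).
Context (ct : 'rV[R]_d -> 'rV[R]_n) (phi : 'rV[R]_n -> 'rV[R]_d -> 'rV[R]_d).
Context (omega : 'rV[R]_d -> R) (node : 'I_N -> 'rV[R]_d) (w : 'I_N -> R).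

Lemma pulled_ratio_gt0 xt xi : 0 < pulled_ratio c theta ct phi xt xi.
Proof.
by rewrite divr_gt0 ?mulr_gt0 ?exprn_gt0 ?expR_gt0.
Qed.

(** The quadrature weights the value at a node by [u > 0], which cancels the
    factor [1 / u]; what remains has coefficients independent of [xi]. *)
Lemma numerical_expectation_pulled_ratioV (V : lmodType R)
    (D : 'rV[R]_d -> V) (xi : 'rV[R]_n) :
  numerical_expectation c theta ct phi omega node w
    (fun xt => (pulled_ratio c theta ct phi xt xi)^-1 *: D xt) xi =
  \sum_(i < N) (w i * (omega (node i))^-1) *: D (node i).
Proof.
apply: eq_bigr => i _; rewrite !scalerA -mulrA; congr ((_ * _) *: _).
by rewrite mulrAC mulfV ?mul1r// gt_eqF// pulled_ratio_gt0.
Qed.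

End quadrature.

Theorem proposition2 (R : realType) (d m n N : nat)
    (c : 'rV[R]_d -> 'rV[R]_m) (ct : 'rV[R]_d -> 'rV[R]_n)
    (theta : 'rV[R]_m)
    (phi : 'rV[R]_n -> 'rV[R]_d -> 'rV[R]_d)
    (omega : 'rV[R]_d -> R) (node : 'I_N -> 'rV[R]_d) (w : 'I_N -> R)
    (Xi0 : set 'rV[R]_n) :
  let Xi : set 'rV[R]_n := [set xi | (cumulant ct xi < +oo)%E] in
  let u := pulled_ratio c theta ct phi in
  let E_N := integration_error c theta ct phi omega node w in
  let EE (V : lmodType R) (F : 'rV[R]_n -> 'rV[R]_d -> V) xi :=
    numerical_expectation c theta ct phi omega node w (F xi) xi in
  regular_EM c ->
  is_Ck 2 setT c ->
  is_Ck 2 setT ct ->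
  natural_parameter_space c theta ->
  (forall xi, Xi xi -> constructed_from ct xi (phi xi)) ->
  (forall xt, cube xt -> 0 < omega xt) ->
  (forall i, cube (node i)) ->
  Xi0 `<=` Xi ->
  open Xi0 ->
  @convex_set R 'rV[R]_n Xi0 ->
  (forall xt xi, cube xt -> Xi0 xi -> twice_differentiable (u xt) xi) ->
  @convex_function R 'rV[R]_n Xi0 (fun xi => E_N (cst 1) xi ^+ 2) <->
  (forall xi, Xi0 xi ->
    loewner_ge
      (EE _ (log_gradient c theta ct phi) xi *m
         (EE _ (log_gradient c theta ct phi) xi)^T)
      (E_N (cst 1) xi *: EE _ (scaled_hessian c theta ct phi) xi)).
Proof.
move=> Xi u E_N EE _ _ _ _ _ _ node_cube _ oXi0 cXi0 tu.
pose a i := w i * (omega (node i))^-1.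
have EE_grad xi : EE _ (log_gradient c theta ct phi) xi =
    \sum_(i < N) a i *: gradient (u (node i)) xi.
  exact: (numerical_expectation_pulled_ratioV c theta ct phi omega node w
    (fun xt => gradient (u xt) xi)).
have EE_hess xi : EE _ (scaled_hessian c theta ct phi) xi =
    \sum_(i < N) a i *: hessian (u (node i)) xi.
  exact: (numerical_expectation_pulled_ratioV c theta ct phi omega node w
    (fun xt => hessian (u xt) xi)).
have E_NE : E_N (cst 1) = (fun xi =>
    expectation_EM c theta (cst 1) - \sum_(i < N) a i * u (node i) xi).
  apply/funext => xi; congr (_ - _); apply: eq_bigr => i _.
  by rewrite /a /u/= /GRing.scale/= mulr1 mulrA mulrAC.
have tE2 xi : Xi0 xi ->
    twice_differentiable (fun xi => E_N (cst 1) xi ^+ 2 : R^o) xi /\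
    hessian (fun xi => E_N (cst 1) xi ^+ 2 : R^o) xi =
    2 *: (EE _ (log_gradient c theta ct phi) xi *m
         (EE _ (log_gradient c theta ct phi) xi)^T -
      E_N (cst 1) xi *: EE _ (scaled_hessian c theta ct phi) xi).
  move=> Xi0xi.
  have [tE gE hE] := twice_differentiable_affine
    (expectation_EM c theta (cst 1)) a
    (fun i => tu _ _ (node_cube i) Xi0xi).
  rewrite -E_NE in tE gE hE.
  have [tE2 ->] := twice_differentiable_sqr tE; split; first exact: tE2.
  by rewrite gE hE -EE_grad -EE_hess linearN/= mulNmx mulmxN opprK scalerN.
split=> [cE xi Xi0xi|psd].
  have [tE hE] := tE2 xi Xi0xi.
  apply/(@psdmxZ _ _ 2) => //; rewrite -hE.
  exact: (@convex_function_psd_hessian _ _ _ Xi0).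
apply: psd_hessian_convex_function => // xi Xi0xi.
  exact: (tE2 xi Xi0xi).1.
by rewrite (tE2 xi Xi0xi).2; apply/psdmxZ => //; exact: psd.
Qed.
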